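(* Let $t\ge 1$ and $r\ge 2$ be integers with $r\le 2t+2$, and let $k=\min\{r-1,t+1\}$. Then, as $n\to\infty$, $$\mathrm{ex}_r(n,\text{Berge-}B_t)=\frac{n^2}{4k(r-k)}+o(n^2).$$
   Context: For a graph $F$ and a hypergraph $\mathcal H$, $\mathcal H$ contains a Berge copy of $F$ (a Berge-$F$) if there is an injection $\varphi:V(F)\to V(\mathcal H)$ and an injection $f:E(F)\to E(\mathcal H)$ such that for every edge $xy\in E(F)$, $\{\varphi(x),\varphi(y)\}\subseteq f(xy)$. $\mathrm{ex}_r(n,\text{Berge-}F)$ denotes the maximum number of hyperedges in an $n$-vertex $r$-uniform hypergraph (hyperedges are distinct $r$-subsets) containing no Berge-$F$. The book graph $B_t$ has vertices $u,v,w_1,\dots,w_t$ and edges $uv$, $uw_i$, $vw_i$ for $1\le i\le t$. *)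

(* Defs.v *)
From mathcomp Require Import all_boot all_order all_algebra.
Set Implicit Arguments. Unset Strict Implicit. Unset Printing Implicit Defensive.

(* A (simple) graph F is given by a finite vertex type V and an edge set
   EF : {set {set V}} (each edge a 2-subset of V). A hypergraph on n vertices
   is a set of subsets of 'I_n (so hyperedges are distinct). *)

Definition uniform (n r : nat) (H : {set {set 'I_n}}) : bool :=
  [forall e in H, #|e| == r].

Definition has_berge (V : finType) (EF : {set {set V}}) (n : nat)
    (H : {set {set 'I_n}}) : bool :=
  [exists phi : {ffun V -> 'I_n},
    injectiveb phi &&
    [exists f : {ffun {set V} -> {set 'I_n}},
      [forall e in EF, (f e \in H) && ((phi @: e) \subset f e)] &&
      [forall e1 in EF, forall e2 in EF, (f e1 == f e2) ==> (e1 == e2)]]].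

Definition ex_berge (r n : nat) (V : finType) (EF : {set {set V}}) : nat :=
  \max_(H : {set {set 'I_n}} | uniform r H && ~~ has_berge EF H) #|H|.

(* Book graph B_t: u = None, v = Some None, w_i = Some (Some i). *)
Definition book_V (t : nat) : finType := option (option 'I_t).

Definition book_E (t : nat) : {set {set book_V t}} :=
  [set [set (None : book_V t); Some None]]
  :|: [set [set (None : book_V t); Some (Some i)] | i : 'I_t]
  :|: [set [set (Some None : book_V t); Some (Some i)] | i : 'I_t].

(* Main.v *)
Require Import Defs.
From mathcomp Require Import all_boot all_order all_algebra.
From mathcomp Require Import zify ring lra.
Set Implicit Arguments. Unset Strict Implicit. Unset Printing Implicit Defensive.
Import Order.TTheory GRing.Theory Num.Theory.

(** Lower bound: split the vertices into two halves, cut them into blocks of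
    size k and r - k respectively, and take all unions of a block of one half
    and a block of the other.  Two vertices in distinct blocks lie in at most
    one hyperedge, which forces a Berge book inside one block, of size at most
    t + 1.

    Upper bound: if a pair xy is covered by a hyperedge, there are only boundedly
    many w with distinct hyperedges through xw and yw, since otherwise a Berge book
    on the spine xy can be chosen greedily.  Hence the shadow graph has O(n^2)
    triangles and, by the proof of Mantel's theorem, at most n^2/4 + o(n^2)
    edges.  It remains to see that all but o(n^2) hyperedges contain k(r - k)
    pairs covered by no other hyperedge.  Up to o(n^2) exceptions, the pairs of
    a hyperedge split into light and heavy ones according to their codegree,
    where heavy pairs form disjoint cliques and light triangles do not occur
    (Ruzsa-Szemeredi: a graph in which every edge lies in boundedly many
    triangles has o(n^2) triangles).  So there are exactly two heavy cliques,
    each of size at most t + 1 because heavy pairs extend greedily to a Berge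
    book, and the pairs between them have codegree 1. *)

(** * Berge books and codegrees *)

Lemma book_edgeP (t : nat) (e : {set book_V t}) :
  reflect [\/ e = [set None; Some None],
              exists i, e = [set None; Some (Some i)]
            | exists i, e = [set Some None; Some (Some i)]]
          (e \in book_E t).
Proof.
rewrite !inE; apply: (iffP idP).
  case/orP=> [/orP[/eqP->|/imsetP[i _ ->]]|/imsetP[i _ ->]].
  - by constructor 1.
  - by constructor 2; exists i.
  - by constructor 3; exists i.
case=> [->|[i ->]|[i ->]]; rewrite ?eqxx //.
  by rewrite (imset_f (fun i => [set None; Some (Some i)])) ?orbT.
by rewrite (imset_f (fun i => [set Some None; Some (Some i)])) ?orbT.
Qed.

(** The interface for producing Berge books: the last four hypotheses make the hyperedges assigned
    to the edges of the book pairwise distinct. *)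
Lemma book_berge (t n : nat) (H : {set {set 'I_n}}) (x y : 'I_n)
    (w : 'I_t -> 'I_n) (h : {set 'I_n}) (p q : 'I_t -> {set 'I_n}) :
  x != y -> injective w -> (forall i, (w i != x) && (w i != y)) ->
  h \in H -> x \in h -> y \in h ->
  (forall i, [&& p i \in H, x \in p i & w i \in p i]) ->
  (forall i, [&& q i \in H, y \in q i & w i \in q i]) ->
  injective p -> injective q -> (forall i, (p i != h) && (q i != h)) ->
  (forall i j, p i != q j) ->
  has_berge (book_E t) H.
Proof.
move=> xy injw wxy hH xh yh Hp Hq injp injq pqh pq.
pose phi : {ffun book_V t -> 'I_n} := [ffun v : book_V t => match v with
  None => x | Some None => y | Some (Some i) => w i end].
(* An edge is decoded from its elements: its page vertex gives [i], and [None] tells which end of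
   the spine it meets; without a page vertex it is the spine. *)
pose f : {ffun {set book_V t} -> {set 'I_n}} := [ffun e : {set book_V t} =>
  if [pick i | (Some (Some i) : book_V t) \in e] is Some i
  then if (None : book_V t) \in e then p i else q i else h].
have fh : f [set None; Some None] = h.
  by rewrite ffunE; case: pickP => // i; rewrite !inE.
have fp i : f [set None; Some (Some i)] = p i.
  rewrite ffunE; case: pickP => [j|/(_ i)]; rewrite !inE ?eqxx //=.
  by move/eqP=> [->].
have fq i : f [set Some None; Some (Some i)] = q i.
  rewrite ffunE; case: pickP => [j|/(_ i)]; rewrite !inE ?eqxx //=.
  by move/eqP=> [->].
apply/existsP; exists phi; apply/andP; split.
  apply/injectiveP => -[[i|]|] [[j|]|]; rewrite !ffunE //.
  - by move/injw->.
  - by have /andP[_ /eqP] := wxy i.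
  - by have /andP[/eqP] := wxy i.
  - by have /andP[_ /eqP+ E] := wxy j; rewrite E.
  - by move/esym/eqP; rewrite (negPf xy).
  - by have /andP[/eqP+ _ E] := wxy j; rewrite E.
  - by move/eqP; rewrite (negPf xy).
apply/existsP; exists f; apply/andP; split.
  apply/forall_inP => e /book_edgeP[->|[i ->]|[i ->]];
    rewrite ?fh ?fp ?fq imsetU1 imset_set1 subUset !sub1set !ffunE.
  - by rewrite hH xh.
  - by case/and3P: (Hp i) => -> -> ->.
  - by case/and3P: (Hq i) => -> -> ->.
apply/forall_inP => e1 e1E; apply/forall_inP => e2 e2E; apply/implyP.
have [pN qN] : (forall i, (p i == h) = false) /\ (forall i, (q i == h) = false).
  by split=> i; case/andP: (pqh i) => /negPf ? /negPf ?.
case/book_edgeP: e1E => [->|[i ->]|[i ->]];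
  case/book_edgeP: e2E => [->|[j ->]|[j ->]];
  rewrite ?fh ?fp ?fq ?eqxx ?pN ?qN ?(eq_sym h) ?pN ?qN ?(negPf (pq _ _)) //.
- by move/eqP/injp->.
- by rewrite eq_sym (negPf (pq _ _)).
- by move/eqP/injq->.
Qed.

Section Hypergraph.
Variables (V : finType) (H : {set {set V}}).

Definition codeg (x y : V) : nat := #|[set h in H | (x \in h) && (y \in h)]|.

(* Together with a hyperedge on [x y], the pair [hh] makes [x y w] a Berge
   triangle. *)
Definition separates (x y w : V) (hh : {set V} * {set V}) : bool :=
  [&& hh.1 \in H, hh.2 \in H, hh.1 != hh.2, (x \in hh.1) && (w \in hh.1)
    & (y \in hh.2) && (w \in hh.2)].

(** The possible page vertices over the spine [x y]; [x] and [y] themselves are not excluded. *)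
Definition apexes (x y : V) : {set V} := [set w | [exists hh, separates x y w hh]].

Lemma codegC x y : codeg x y = codeg y x.
Proof. by apply: eq_card => h; rewrite !inE [(x \in h) && _]andbC. Qed.

Lemma apexesC x y : apexes x y = apexes y x.
Proof.
apply/setP=> w; rewrite !inE; apply/existsP/existsP => -[[h1 h2]];
  case/and5P=> ? ? ? ? ?; exists (h2, h1); apply/and5P; split=> //=;
  by rewrite eq_sym.
Qed.

Lemma codeg_gt0 x y h : h \in H -> x \in h -> y \in h -> 0 < codeg x y.
Proof. by move=> hH xh yh; apply/card_gt0P; exists h; rewrite inE hH xh. Qed.

Lemma codeg_gt1P x y h : h \in H -> x \in h -> y \in h -> 1 < codeg x y ->
  exists h', [/\ h' \in H, x \in h', y \in h' & h' != h].
Proof.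
move=> hH xh yh; rewrite /codeg (cardsD1 h) inE hH xh yh ltnS.
case/card_gt0P => h'; rewrite !inE => /andP[ne /and3P[h'H xh' yh']].
by exists h'.
Qed.

(** A second hyperedge through [x w] or [y w] forms a separating pair with [h]. *)
Lemma apexes_codeg x y w h : h \in H -> x \in h -> y \in h -> w \in h ->
  (1 < codeg x w) || (1 < codeg y w) -> w \in apexes x y.
Proof.
move=> hH xh yh wh /orP[] c1.
  have [h' [h'H xh' wh' ne]] := codeg_gt1P hH xh wh c1.
  rewrite inE; apply/existsP; exists (h', h).
  by rewrite /separates /= h'H hH ne xh' wh' yh wh.
have [h' [h'H xh' wh' ne]] := codeg_gt1P hH yh wh c1.
rewrite inE; apply/existsP; exists (h, h').
by rewrite /separates /= h'H hH eq_sym ne xh' wh' xh wh.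
Qed.

End Hypergraph.

(** Pages are chosen greedily: [h] blocks [r] vertices, and each earlier page blocks at most [2 * r]
    through its two hyperedges, so more than [r + 2 * r * t] apexes yield [t] pages. *)
Lemma card_apexes (t r n : nat) (H : {set {set 'I_n}}) (x y : 'I_n) :
  uniform r H -> ~~ has_berge (book_E t) H -> x != y -> 0 < codeg H x y ->
  #|apexes H x y| <= r * (2 * t + 1).
Proof.
move=> /forall_inP Hr noB xy /card_gt0P[h]; rewrite inE => /and3P[hH xh yh].
rewrite leqNgt; apply: contra noB => many.
pose pq w := odflt (set0, set0) [pick hh | separates H x y w hh].
have pqP w : w \in apexes H x y -> separates H x y w (pq w).
  rewrite inE => /existsP[hh s]; rewrite /pq.
  by case: pickP => //= /(_ hh); rewrite s.
pose cov w := (pq w).1 :|: (pq w).2.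
have card_cov w : w \in apexes H x y -> #|cov w| <= 2 * r.
  case/pqP/and5P=> /Hr/eqP c1 /Hr/eqP c2 _ _ _.
  by rewrite (leq_trans (leq_card_setU _ _)) // c1 c2 addnn mul2n.
(* New pages go to the head of the list, so each page avoids the hyperedges of those that follow it
   in [s]. *)
have greedy j : j <= t -> exists s : seq 'I_n, [/\ size s = j,
    {subset s <= apexes H x y :\: h} & pairwise (fun a b => a \notin cov b) s].
  elim: j => [|j IH] jt; first by exists [::]; split.
  have [s [sj sA sp]] := IH (ltnW jt).
  pose B := h :|: \bigcup_(b <- s) cov b.
  have cB : #|B| <= r * (2 * t + 1).
    apply: leq_trans (leq_card_setU _ _) _; rewrite (eqP (Hr _ hH)).
    have : #|\bigcup_(b <- s) cov b| <= size s * (2 * r).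
      elim: (s) sA => [|b s' IHs] sA; first by rewrite big_nil cards0.
      rewrite big_cons mulSn; apply: leq_trans (leq_card_setU _ _) _.
      apply: leq_add; first by have /setDP[/card_cov] := sA b (mem_head _ _).
      by apply: IHs => b' b's; apply: sA; rewrite inE b's orbT.
    rewrite sj; nia.
  have /subsetPn[w wA wB] : ~~ (apexes H x y \subset B).
    by apply: contraL many => /subset_leq_card le; rewrite -leqNgt (leq_trans le).
  move: wB; rewrite inE negb_or => /andP[wh wB].
  exists (w :: s); split; first by rewrite /= sj.
    by move=> b; rewrite inE => /orP[/eqP->|/sA //]; rewrite inE wh.
  rewrite /= sp andbT; apply/allP => b bs; apply: contra wB => wb.
  by rewrite bigcup_seq; apply/bigcupP; exists b.
have [s [st sA sp]] := greedy t (leqnn t).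
pose w (i : 'I_t) := nth x s i.
have wA i : w i \in apexes H x y :\: h by apply: sA; rewrite mem_nth ?st.
have wP i : separates H x y (w i) (pq (w i)) by apply: pqP; case/setDP: (wA i).
have wh i : w i \notin h by case/setDP: (wA i).
have wcov i j : i != j -> (w i \notin cov (w j)) || (w j \notin cov (w i)).
  move=> ij; have /(pairwiseP x) P := sp.
  case: (ltngtP i j) => [lt|lt|/val_inj E]; last by rewrite E eqxx in ij.
    by rewrite (P i j) ?inE ?st.
  by rewrite orbC (P j i) ?inE ?st.
(* Avoidance in one direction suffices: a hyperedge shared by two pages would put each of them into
   the [cov] of the other. *)
have cov_inj i j (g g' : {set 'I_n}) : w i \in g -> w j \in g' -> g \subset cov (w i) ->
    g' \subset cov (w j) -> g = g' -> i = j.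
  move=> ig jg' gi gj E; apply/eqP; apply: contraT => /wcov.
  by rewrite (subsetP gj) -?E // (subsetP gi) // E.
have subl i : (pq (w i)).1 \subset cov (w i) by exact: subsetUl.
have subr i : (pq (w i)).2 \subset cov (w i) by exact: subsetUr.
have w1 i : w i \in (pq (w i)).1 by case/and5P: (wP i) => _ _ _ /andP[].
have w2 i : w i \in (pq (w i)).2 by case/and5P: (wP i) => _ _ _ _ /andP[].
apply: (@book_berge t n H x y w h (fun i => (pq (w i)).1) (fun i => (pq (w i)).2)) => //.
- move=> i j E; apply: (cov_inj i j _ _ (w1 i) (w1 j) (subl i) (subl j)).
  by rewrite E.
- by move=> i; rewrite !(contraNneq _ (wh i)) // => ->.
- by move=> i; case/and5P: (wP i) => -> _ _ /andP[-> ->] _.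
- by move=> i; case/and5P: (wP i) => _ -> _ _ /andP[-> ->].
- by move=> i j; exact: (cov_inj i j _ _ (w1 i) (w1 j) (subl i) (subl j)).
- by move=> i j; exact: (cov_inj i j _ _ (w2 i) (w2 j) (subr i) (subr j)).
- move=> i; apply/andP; split; apply: contraNneq (wh i) => <-.
    exact: w1.
  exact: w2.
- move=> i j; apply/eqP=> E.
  have ij := cov_inj i j _ _ (w1 i) (w2 j) (subl i) (subr j) E.
  by move: E; rewrite ij => /eqP; case/and5P: (wP j) => _ _ /negPf->.
Qed.

(** * Hyperedges of book-free hypergraphs *)

(** Ordered triples: in a loopless symmetric graph each triangle counts six times. *)
Definition triangles (V : finType) (e : rel V) : nat :=
  \sum_x \sum_y \sum_z [&& e x y, e x z & e y z].

(** Cauchy-Schwarz bounds the square of the degree sum by the sum of squared degrees. Twice the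
    latter is the sum of [d x + d y] over ordered adjacent pairs, and [d x + d y] is at most [#|V|]
    plus the number of common neighbours. *)
Lemma mantel (V : finType) (e : rel V) : symmetric e ->
  2 * (\sum_x \sum_y e x y) ^ 2
    <= #|V| ^ 2 * (\sum_x \sum_y e x y) + #|V| * triangles e.
Proof.
move=> es; pose d x := \sum_y e x y.
have dE x : d x = #|[pred y | e x y]|.
  by rewrite -sum1_card [RHS]big_mkcond; apply: eq_bigr => y _; rewrite inE; case: (e x y).
rewrite -/(\sum_x d x).
have cs : 2 * (\sum_x d x) ^ 2 <= 2 * (#|V| * \sum_x d x ^ 2).
  have -> : 2 * (#|V| * \sum_x d x ^ 2) = \sum_x \sum_y (d x ^ 2 + d y ^ 2).
    rewrite [RHS](eq_bigr (fun x => #|V| * d x ^ 2 + \sum_y d y ^ 2)).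
      by rewrite big_split /= sum_nat_const -big_distrr /= mul2n addnn.
    by move=> x _; rewrite big_split /= sum_nat_const.
  rewrite -mulnn big_distrlr big_distrr; apply: leq_sum => x _.
  rewrite big_distrr; apply: leq_sum => y _ /=; exact: nat_Cauchy.
have inc : 2 * \sum_x d x ^ 2 <= #|V| * (\sum_x d x) + triangles e.
  have -> : 2 * \sum_x d x ^ 2 = \sum_x \sum_y e x y * (d x + d y).
    under [RHS]eq_bigr => x _ do
      (under eq_bigr => y _ do rewrite mulnDr; rewrite big_split /= -big_distrl /=).
    rewrite big_split /= [X in _ = _ + X]exchange_big /=.
    under [X in _ = _ + X]eq_bigr => y _ do
      (under eq_bigr => x _ do rewrite es; rewrite -big_distrl /=).
    by rewrite mul2n -addnn.
  rewrite /triangles big_distrr -big_split; apply: leq_sum => x _ /=.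
  rewrite big_distrr -big_split; apply: leq_sum => y _ /=.
  case: (e x y) => //=; rewrite mul1n muln1 !dE -cardUI leq_add ?max_card //.
  by rewrite -sum1_card big_mkcond; apply: leq_sum => z _; rewrite !inE; case: andP.
nia.
Qed.

Lemma card_cover_le (I T : finType) (S : pred I) (F : {set T}) (G : I -> {set T}) :
  (forall h, h \in F -> exists2 i, S i & h \in G i) ->
  #|F| <= \sum_(i | S i) #|G i|.
Proof.
move=> FG; have : F \subset \bigcup_(i | S i) G i.
  by apply/subsetP => h /FG[i Si hG]; apply/bigcupP; exists i.
move/subset_leq_card/leq_trans; apply.
elim/big_rec2: _ => [|i m X _ le]; first by rewrite cards0.
by apply: leq_trans (leq_card_setU _ _) _; rewrite leq_add2l.
Qed.

(** Double counting of triples [(x, y, h)]; the diagonal [x = y] is included, hence the full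
    square. *)
Lemma sum_codeg (V : finType) (H : {set {set V}}) :
  \sum_x \sum_y codeg H x y = \sum_(h in H) #|h| ^ 2.
Proof.
transitivity (\sum_x \sum_y \sum_(h in H) ((x \in h) * (y \in h))).
  apply: eq_bigr => x _; apply: eq_bigr => y _.
  rewrite /codeg -sum1_card big_mkcond [RHS]big_mkcond /=.
  by apply: eq_bigr => h _; rewrite inE; case: (h \in H); case: (x \in h); case: (y \in h).
under eq_bigr do rewrite exchange_big.
rewrite exchange_big; apply: eq_bigr => h _ /=.
under eq_bigr do rewrite -big_distrr /=.
rewrite -big_distrl /= -mulnn.
have -> : \sum_x (x \in h) = #|h| by rewrite -sum1_card [RHS]big_mkcond.
by [].
Qed.

(** For a fixed sum the product shrinks as the parts move apart, and [k] is the largest part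
    allowed. *)
Lemma minn_product_le (a b t : nat) : 0 < a -> 0 < b -> a <= t + 1 -> b <= t + 1 ->
  minn (a + b - 1) (t + 1) * (a + b - minn (a + b - 1) (t + 1)) <= a * b.
Proof.
move=> a0 b0 at1 bt1; set k := minn _ _.
have ak : a <= k by rewrite /k; lia.
have bk : b <= k by rewrite /k; lia.
have kab : k <= a + b by rewrite /k; lia.
(* With [k = a + d] and [b = d + e] the claim reduces to [d * e <= a * d], where [e <= a] follows
   from [b <= k]. *)
clearbody k; move: bk kab; rewrite -(subnKC ak); move: (k - a) => d bk kab.
have db : d <= b by lia.
move: bk; rewrite -(subnKC db); move: (b - d) => e bk.
have -> : a + (d + e) - (a + d) = e by lia.
rewrite mulnDl mulnDr addnC leq_add2r mulnC leq_mul2r; lia.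
Qed.

(** The light pairs for threshold [M]; for [M = 1] these are the pairs covered by exactly one
    hyperedge. *)
Definition linked (V : finType) (H : {set {set V}}) (M : nat) : rel V :=
  fun x y => [&& x != y, 0 < codeg H x y & codeg H x y <= M].

Lemma linked_sym (V : finType) (H : {set {set V}}) M : symmetric (linked H M).
Proof. by move=> x y; rewrite /linked eq_sym codegC. Qed.

(** * Counting hyperedges of a fixed book-free hypergraph *)

Section BookFree.
Variables (t r n : nat) (H : {set {set 'I_n}}).
Hypotheses (r_ge2 : 2 <= r) (Hr : uniform r H) (H_free : ~~ has_berge (book_E t) H).

(** [C] bounds the number of apexes over a covered pair, and [B] the number of subsets of an apex
    set enlarged by the two ends of its spine. *)
Let C := r * (2 * t + 1).
Let B := 2 ^ (C + 2).

Let card_edge h : h \in H -> #|h| = r.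
Proof. by move/forall_inP: Hr => Hr' /Hr'/eqP. Qed.

Let sum_codegE : \sum_x \sum_y codeg H x y = r ^ 2 * #|H|.
Proof.
by rewrite sum_codeg mulnC -sum_nat_const; apply: eq_bigr => h /card_edge->.
Qed.

Let edge_pair h : h \in H -> exists x y, [/\ x != y, x \in h & y \in h].
Proof.
move=> hH; have : 1 < #|h| by rewrite card_edge.
by case/card_gt1P => x [y [xh yh xy]]; exists x, y.
Qed.

Let card_G x y : x != y -> 0 < codeg H x y ->
  #|[set h in H | h \subset x |: (y |: apexes H x y)]| <= B.
Proof.
move=> xy c0; have -> : B = 2 ^ (C + 2) by [].
apply: (@leq_trans #|powerset (x |: (y |: apexes H x y))|).
  by apply/subset_leq_card/subsetP => h; rewrite !inE => /andP[].
rewrite card_powerset leq_exp2l // !cardsU1.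
by have := card_apexes Hr H_free xy c0; rewrite -/C; case: (x \notin _); case: (y \notin _); lia.
Qed.

(** Any third vertex [z] of [h] lies with [x] in a second hyperedge, so it is an apex over [x y]. *)
Let heavy_sub x y h : h \in H -> x \in h -> y \in h ->
  (forall u v, u \in h -> v \in h -> u != v -> 1 < codeg H u v) ->
  h \subset x |: (y |: apexes H x y).
Proof.
move=> hH xh yh heavy; apply/subsetP => z zh; rewrite !inE.
case: (eqVneq z x) => //= zx; case: (eqVneq z y) => //= zy.
have := @apexes_codeg _ H x y z h hH xh yh zh; rewrite inE; apply.
by rewrite heavy // eq_sym.
Qed.

(** Each hyperedge is charged to one of its pairs of codegree 1, or, if there is none, to any of its
    pairs, whose apexes then cover it. No pair is charged more than [B] times. *)
Lemma card_book_free : #|H| <= n ^ 2 * B.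
Proof.
pose G (p : 'I_n * 'I_n) := [set h in H | [&& p.1 \in h, p.2 \in h &
  (codeg H p.1 p.2 <= 1) || (h \subset p.1 |: (p.2 |: apexes H p.1 p.2))]].
apply: leq_trans (@card_cover_le _ _ (fun p => p.1 != p.2) H G _) _.
  move=> h hH; have [|] := boolP [exists p : 'I_n * 'I_n,
    [&& p.1 != p.2, p.1 \in h, p.2 \in h & codeg H p.1 p.2 <= 1]].
    by case/existsP=> p /and4P[ne ph ph' c]; exists p; rewrite // inE hH ph ph' c.
  rewrite negb_exists => /forallP heavy.
  have [x [y [xy xh yh]]] := edge_pair hH; exists (x, y) => //=.
  rewrite inE hH /= xh yh heavy_sub ?orbT // => u v uh vh uv.
  by have := heavy (u, v); rewrite /= uv uh vh /= ltnNge.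
have -> : n ^ 2 * B = \sum_(p : 'I_n * 'I_n) B.
  by rewrite sum_nat_const card_prod card_ord mulnn.
rewrite big_mkcond; apply: leq_sum => -[x y] _ /=; case: ifP => // xy.
case: (leqP (codeg H x y) 1) => [c1|c1].
  apply: (@leq_trans (codeg H x y)).
    by apply/subset_leq_card/subsetP => h; rewrite !inE => /and4P[-> -> ->].
  by apply: leq_trans c1 _; rewrite expn_gt0.
apply: leq_trans (card_G xy (ltnW c1)).
apply/subset_leq_card/subsetP => h; rewrite !inE /= leqNgt c1 /=.
by case/and4P=> -> _ _ ->.
Qed.

(* Each such hyperedge is contained in [x |: (y |: apexes H x y)] for any two of
   its vertices, and by double counting few pairs have codegree above [D]. *)
Lemma card_all_heavy D : 0 < D ->
  D * #|[set h in H | [forall x in h, forall y in h, (x != y) ==> (D < codeg H x y)]]|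
    <= B * r ^ 2 * #|H|.
Proof.
move=> D0; set F := [set _ in _ | _].
pose S (p : 'I_n * 'I_n) := (p.1 != p.2) && (D < codeg H p.1 p.2).
pose G (p : 'I_n * 'I_n) := [set h in H | h \subset p.1 |: (p.2 |: apexes H p.1 p.2)].
have FS : #|F| <= \sum_(p | S p) #|G p|.
  apply: card_cover_le => h; rewrite inE => /andP[hH /forall_inP heavy].
  have heavy' u v : u \in h -> v \in h -> u != v -> D < codeg H u v.
    by move=> uh vh uv; have /forall_inP/(_ _ vh) := heavy u uh; rewrite uv.
  have [x [y [xy xh yh]]] := edge_pair hH.
  exists (x, y); first by rewrite /S xy heavy'.
  rewrite inE hH heavy_sub // => u v uh vh uv.
  by apply: leq_trans (heavy' _ _ uh vh uv).
apply: leq_trans (leq_mul (leqnn D) FS) _.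
rewrite -mulnA -sum_codegE pair_bigA big_distrr /= big_distrr /= [leqLHS]big_mkcond.
apply: leq_sum => -[x y] _ /=; rewrite /S /=; case: ifP => // /andP[xy c].
by rewrite mulnC leq_mul // ?(ltnW c) // card_G // (leq_trans _ c).
Qed.

(** Such a hyperedge is charged to the pair [u x]. For fixed [u v] there are at most [C] apexes [x],
    each with [L * codeg H u x] below [codeg H u v]; summing the codegrees over all [u v] gives the
    bound. *)
Lemma card_unbalanced L :
  L * #|[set h in H | [exists u in h, exists v in h, exists x in h,
     [&& u != v, x \in apexes H u v & L * codeg H u x < codeg H u v]]]|
    <= C * r ^ 2 * #|H|.
Proof.
set F := [set _ in _ | _].
pose S (p : 'I_n * ('I_n * 'I_n)) := [&& p.1 != p.2.1, p.2.2 \in apexes H p.1 p.2.1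
  & L * codeg H p.1 p.2.2 < codeg H p.1 p.2.1].
pose G (p : 'I_n * ('I_n * 'I_n)) := [set h in H | (p.1 \in h) && (p.2.2 \in h)].
have FS : #|F| <= \sum_(p | S p) #|G p|.
  apply: card_cover_le => h; rewrite inE => /andP[hH].
  case/exists_inP=> u uh /exists_inP[v vh /exists_inP[x xh uvx]].
  by exists (u, (v, x)) => //; rewrite inE hH uh xh.
apply: leq_trans (leq_mul (leqnn L) FS) _.
rewrite -mulnA -sum_codegE big_distrr /= big_mkcond.
rewrite -(pair_bigA _ (fun u q => if S (u, q) then L * #|G (u, q)| else 0)) /=.
rewrite big_distrr; apply: leq_sum => u _ /=.
rewrite -(pair_bigA _ (fun v x => if S (u, (v, x)) then L * #|G (u, (v, x))| else 0)) /=.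
rewrite big_distrr; apply: leq_sum => v _ /=.
case: (posnP (codeg H u v)) => [c0|c0].
  by rewrite big1 // => x _; rewrite /S /= c0 ltn0 !andbF.
case: (eqVneq u v) => [->|uv]; first by rewrite big1 // => x _; rewrite /S /= eqxx.
apply: leq_trans (leq_mul (card_apexes Hr H_free uv c0) (leqnn _)).
rewrite -sum_nat_const [leqRHS]big_mkcond; apply: leq_sum => x _.
by rewrite /S /= uv; case: ifP => //= /andP[-> /ltnW].
Qed.

(** A light triangle lies in at most [codeg H u v <= M] hyperedges. *)
Lemma card_light_triangles M :
  #|[set h in H | [exists u in h, exists v in h, exists x in h,
     [&& linked H M u v, linked H M u x & linked H M v x]]]|
    <= M * triangles (linked H M).
Proof.
set F := [set _ in _ | _].
pose S (p : 'I_n * ('I_n * 'I_n)) := [&& linked H M p.1 p.2.1,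
  linked H M p.1 p.2.2 & linked H M p.2.1 p.2.2].
pose G (p : 'I_n * ('I_n * 'I_n)) := [set h in H | (p.1 \in h) && (p.2.1 \in h)].
have FS : #|F| <= \sum_(p | S p) #|G p|.
  apply: card_cover_le => h; rewrite inE => /andP[hH].
  case/exists_inP=> u uh /exists_inP[v vh /exists_inP[x xh uvx]].
  by exists (u, (v, x)) => //; rewrite inE hH uh vh.
apply: leq_trans FS _.
rewrite /triangles pair_bigA big_distrr /=.
rewrite big_mkcond.
rewrite -(pair_bigA _ (fun u q => if S (u, q) then #|G (u, q)| else 0)) /=.
rewrite -(pair_bigA _ (fun u v => M * \sum_x
   [&& linked H M u v, linked H M u x & linked H M v x])) /=.
apply: leq_sum => u _.
rewrite -(pair_bigA _ (fun v x => if S (u, (v, x)) then #|G (u, (v, x))| else 0)) /=.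
apply: leq_sum => v _; rewrite big_distrr; apply: leq_sum => x _ /=.
by rewrite /S /=; case: ifP => // /andP[/and3P[_ _]]; rewrite muln1.
Qed.

(** Take hyperedges through [u x] and [v x]: if they differ, [x] is an apex; if they coincide, [x]
    lies in one of the hyperedges through [u v]. *)
Lemma linked_common M u v : linked H M u v ->
  #|[pred x | linked H M u x && linked H M v x]| <= C + codeg H u v * r.
Proof.
case/and3P=> uv c0 _.
pose X := \bigcup_(h in [set h in H | (u \in h) && (v \in h)]) h.
have cX : #|X| <= codeg H u v * r.
  rewrite /codeg -sum_nat_const.
  apply: (@leq_trans (\sum_(h in [set h in H | (u \in h) && (v \in h)]) #|h|)).
    by apply: card_cover_le => x /bigcupP[h]; exists h.
  by apply: leq_sum => h; rewrite inE => /andP[/card_edge->].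
apply: leq_trans (leq_add (card_apexes Hr H_free uv c0) cX).
apply: leq_trans (leq_card_setU _ _).
apply/subset_leq_card/subsetP => x; rewrite inE => /andP[].
case/and3P=> _ /card_gt0P[h1] + _ /and3P[_ /card_gt0P[h2] + _].
rewrite !inE => /and3P[h1H u1 x1] /and3P[h2H v2 x2].
case: (eqVneq h1 h2) => [E|ne]; apply/orP.
  by right; apply/bigcupP; exists h1 => //; rewrite inE h1H u1 E.
left; apply/existsP; exists (h1, h2).
by rewrite /separates /= h1H h2H ne u1 x1 v2 x2.
Qed.

(** Summing [linked_common] over all pairs turns the codegrees into [r ^ 2 * #|H|], so the bound
    does not depend on [M]. *)
Lemma shadow_triangles M :
  triangles (linked H M) <= C * n ^ 2 + r * (r ^ 2 * #|H|).
Proof.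
rewrite -sum_codegE.
have -> : C * n ^ 2 + r * (\sum_x \sum_y codeg H x y) =
          \sum_x \sum_y (C + codeg H x y * r).
  under [RHS]eq_bigr do rewrite big_split /= sum_nat_const card_ord -big_distrl /=.
  rewrite big_split /= sum_nat_const card_ord -big_distrl /=.
  by rewrite [n * (n * C)]mulnA mulnn [r * _]mulnC [C * _]mulnC.
apply: leq_sum => x _; apply: leq_sum => y _.
case xy: (linked H M x y); last by rewrite big1.
apply: leq_trans (linked_common xy).
by rewrite -sum1_card [leqRHS]big_mkcond; apply: leq_sum => z _; rewrite inE; case: (linked H M x z); case: (linked H M y z).
Qed.

(** On [t + 2] such vertices the book is placed arbitrarily; every edge then has at least as many
    candidate hyperedges as the book has edges, so distinct ones can be picked one after another. *)
Lemma card_clique (A : {set 'I_n}) :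
  (forall x y, x \in A -> y \in A -> x != y -> #|book_E t| <= codeg H x y) ->
  #|A| <= t + 1.
Proof.
move=> clique; rewrite leqNgt; apply: contra H_free => many.
have card_V : #|book_V t| <= #|A| by rewrite !card_option card_ord; move: many; rewrite addn1.
pose phi : {ffun book_V t -> 'I_n} :=
  [ffun v => enum_val (widen_ord card_V (enum_rank v))].
have phiA v : phi v \in A by rewrite ffunE enum_valP.
have inj_phi : injective phi.
  move=> u v; rewrite !ffunE => /enum_val_inj/(congr1 val) /= /val_inj.
  exact: enum_rank_inj.
pose S (e : {set book_V t}) := [set h in H | phi @: e \subset h].
have cS e : e \in book_E t -> #|book_E t| <= #|S e|.
  move=> eE; have [a [b [ab ->]]] : exists a b, a != b /\ e = [set a; b].
    case/book_edgeP: eE => [->|[i ->]|[i ->]].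
    - by exists None, (Some None).
    - by exists None, (Some (Some i)).
    - by exists (Some None), (Some (Some i)).
  have := clique (phi a) (phi b) (phiA a) (phiA b); rewrite (inj_eq inj_phi) => /(_ ab).
  move/leq_trans; apply; apply/subset_leq_card/subsetP => h; rewrite !inE.
  by case/and3P=> -> ah bh; rewrite imsetU1 imset_set1 subUset !sub1set ah bh.
have [f fS f_inj] : exists2 f : {set book_V t} -> {set 'I_n},
    {in enum (book_E t), forall e, f e \in S e} & {in enum (book_E t) &, injective f}.
  have: {in enum (book_E t), forall e, size (enum (book_E t)) <= #|S e|}.
    by move=> e; rewrite mem_enum -cardE; exact: cS.
  have := enum_uniq (book_E t).
  elim: (enum _) => [|e s IH] /=; first by exists (fun=> set0).
  case/andP=> es us large.
  have [|f fS finj] := IH us.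
    by move=> e' e's; apply: leq_trans (large _ _); rewrite // inE e's orbT.
  have /subsetPn[h hS hf] : ~~ (S e \subset [set f e' | e' in s]).
    apply/negP => /subset_leq_card; rewrite leqNgt => /negP; apply.
    apply: leq_ltn_trans (leq_imset_card _ _) _.
    by apply: leq_ltn_trans (card_size _) _; apply: large; exact: mem_head.
  exists (fun e' => if e' == e then h else f e').
    move=> e'; rewrite inE; case: eqP => [-> _ //|_ /= e's]; exact: fS.
  have hN e' : e' \in s -> h <> f e'.
    by move=> e's hE; case/negP: hf; rewrite hE; apply: imset_f.
  move=> e1 e2; rewrite !inE.
  case: eqP => [->|_] /=; case: eqP => [->|_] //= m1 m2.
  - by move/(hN _ m2).
  - by move/esym/(hN _ m1).
  - exact: finj.
apply/existsP; exists phi; apply/andP; split; first exact/injectiveP.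
apply/existsP; exists (finfun f); apply/andP; split.
  apply/forall_inP => e eE; rewrite ffunE.
  by have := fS e; rewrite mem_enum => /(_ eE); rewrite inE.
apply/forall_inP => e1 E1; apply/forall_inP => e2 E2; apply/implyP.
by rewrite !ffunE => /eqP/f_inj->; rewrite ?mem_enum.
Qed.

(* With [u v] a pair of codegree at most [D] in [h], every other vertex of [h] is
   heavily joined (codegree above [L * D]) to exactly one of [u] and [v]; the
   two resulting parts are the heavy cliques. *)
Lemma private_pairs_ge (L D : nat) (h : {set 'I_n}) :
  let k := minn (r - 1) (t + 1) in
  h \in H -> 0 < D -> 0 < L -> #|book_E t| <= D ->
  ~~ [forall x in h, forall y in h, (x != y) ==> (D < codeg H x y)] ->
  ~~ [exists u in h, exists v in h, exists x in h,
     [&& u != v, x \in apexes H u v & L * codeg H u x < codeg H u v]] ->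
  ~~ [exists u in h, exists v in h, exists x in h,
     [&& linked H (L * D) u v, linked H (L * D) u x & linked H (L * D) v x]] ->
  2 * (k * (r - k)) <=
    \sum_x \sum_y [&& x \in h, y \in h, x != y & codeg H x y == 1].
Proof.
move=> k hH D0 L0 bookD not_heavy balanced no_light.
pose M := L * D.
have LM : L <= M by rewrite leq_pmulr.
have DM : D <= M by rewrite leq_pmull.
have M1 : 0 < M by apply: leq_trans DM.
have pos x y : x \in h -> y \in h -> 0 < codeg H x y by exact: codeg_gt0.
have rule u v x : u \in h -> v \in h -> x \in h -> u != v ->
    (1 < codeg H u x) || (1 < codeg H v x) -> codeg H u v <= L * codeg H u x.
  move=> uh vh xh uv c1; rewrite leqNgt; apply: contra balanced => lt.
  apply/exists_inP; exists u => //; apply/exists_inP; exists v => //.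
  by apply/exists_inP; exists x; rewrite // uv lt (apexes_codeg hH).
have [u [v [uh vh uv uvD]]] : exists u v, [/\ u \in h, v \in h, u != v & codeg H u v <= D].
  move: not_heavy; rewrite negb_forall => /existsP[u]; rewrite negb_imply => /andP[uh].
  rewrite negb_forall => /existsP[v]; rewrite negb_imply => /andP[vh].
  by rewrite negb_imply -leqNgt => /andP[uv c]; exists u, v.
have some w : w \in h -> w != u -> w != v -> (M < codeg H u w) || (M < codeg H v w).
  move=> wh wu wv; apply: contraR no_light; rewrite negb_or -!leqNgt => /andP[cu cv].
  apply/exists_inP; exists u => //; apply/exists_inP; exists v => //.
  apply/exists_inP; exists w; rewrite // /linked uv !pos //=.
  by rewrite cu cv (leq_trans uvD DM) eq_sym wu eq_sym wv.
(* Otherwise balance makes the codegrees of [u w] and [v w] at most [L * D = M] for every third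
   vertex [w], against [some]. A third vertex exists, since for [r = 2] no other hyperedge contains
   [u] and [v]. *)
have uv1 : codeg H u v = 1.
  apply/eqP; rewrite eqn_leq pos // andbT leqNgt; apply/negP => c1.
  have [w wh wuv] : exists2 w, w \in h & w \notin [set u; v].
    apply/subsetPn/negP => hsub.
    have [h' [h'H uh' vh' /eqP]] := codeg_gt1P hH uh vh c1; apply.
    have c2 : #|[set u; v]| = 2 by rewrite cards2 uv.
    have rle2 : r <= 2 by rewrite -(card_edge hH) -c2 subset_leq_card.
    have sub g : g \in H -> u \in g -> v \in g -> g = [set u; v].
      move=> gH ug vg; apply/esym/eqP; rewrite eqEcard c2 (card_edge gH) rle2 andbT.
      by rewrite subUset !sub1set ug vg.
    by rewrite (sub h') // (sub h).
  move: wuv; rewrite !inE negb_or => /andP[wu wv].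
  case/orP: (some w wh wu wv); rewrite ltnNge => /negP; apply.
    apply: leq_trans (rule u w v uh wh vh _ _) _; first by rewrite eq_sym.
      by rewrite c1.
    by rewrite leq_mul2l uvD orbT.
  apply: leq_trans (rule v w u vh wh uh _ _) _; first by rewrite eq_sym.
    by rewrite codegC c1.
  by rewrite leq_mul2l codegC uvD orbT.
pose near c w := (w == c) || (M < codeg H c w).
(* Heaviness is transitive up to a factor [L]: balance gives
   [L * D < codeg H c w <= L * codeg H w w']. *)
have inside c w w' : c \in h -> w \in h -> w' \in h -> near c w -> near c w' ->
    w != w' -> D < codeg H w w'.
  move=> ch wh w'h /orP[/eqP->|cw] /orP[/eqP->|cw'] ww'.
  - by rewrite eqxx in ww'.
  - exact: leq_ltn_trans cw'.
  - by rewrite codegC; apply: leq_ltn_trans cw.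
  - have [wc|wc] := eqVneq w c.
      by rewrite wc; apply: leq_ltn_trans cw'.
    have := rule w c w' wh ch w'h wc; rewrite (leq_ltn_trans M1 cw') orbT => /(_ isT).
    by rewrite codegC => /(leq_trans cw); rewrite /M ltn_pmul2l.
pose A := [set w in h | (w != v) && near u w].
pose B' := h :\: A.
have AP w : w \in A -> [/\ w \in h, w != v & near u w] by rewrite inE => /and3P[].
have BP w : w \in B' -> [/\ w \in h, w != u & near v w].
  rewrite !inE => /andP[+ wh]; rewrite wh /= negb_and negbK /near.
  have [->|wv] := eqVneq w v; first by rewrite eq_sym uv.
  rewrite /= negb_or => /andP[wu cu]; split=> //.
  by have := some w wh wu wv; rewrite (negPf cu).
(* If [w v] had codegree above 1, balance would give [codeg H u w <= L * codeg H u v = L <= M], so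
   [w] would not be near [u]. The same argument around [v] then proves [cross]. *)
have cross_u w : w \in A -> codeg H w v = 1.
  case/AP=> wh wv; rewrite /near; have [->//|wu /= cu] := eqVneq w u.
  apply/eqP; rewrite eqn_leq pos // andbT leqNgt; apply: contraL cu => c1.
  rewrite -leqNgt; apply: leq_trans LM; rewrite -[leqRHS]muln1 -uv1.
  by apply: rule; rewrite // 1?eq_sym // c1 orbT.
have cross w w' : w \in A -> w' \in B' -> codeg H w w' = 1.
  move=> wA; have [wh wv nuw] := AP _ wA; case/BP=> w'h w'u.
  rewrite /near; have [->|w'v /= cv] := eqVneq w' v; first by move=> _; exact: cross_u.
  apply/eqP; rewrite eqn_leq pos // andbT leqNgt; apply: contraL cv => c1.
  rewrite -leqNgt; apply: leq_trans LM; rewrite -[leqRHS]muln1 -(cross_u _ wA).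
  rewrite [codeg H w v]codegC.
  by apply: rule; rewrite // 1?eq_sym // [codeg H w' w]codegC c1 orbT.
have Ah : A \subset h by apply/subsetP => w /AP[].
have uA : u \in A by rewrite inE uh uv /near eqxx.
have vB : v \in B' by rewrite !inE vh eqxx.
have cA : #|A| <= t + 1.
  apply: card_clique => x y /AP[xh _ nx] /AP[yh _ ny] xy.
  by apply: leq_trans bookD (ltnW (inside u _ _ _ _ _ _ _ _)).
have cB : #|B'| <= t + 1.
  apply: card_clique => x y /BP[xh _ nx] /BP[yh _ ny] xy.
  by apply: leq_trans bookD (ltnW (inside v _ _ _ _ _ _ _ _)).
have AB : #|A| + #|B'| = r by rewrite -(card_edge hH) -(cardsID A h) (setIidPr Ah).
have A1 : 0 < #|A| by apply/card_gt0P; exists u.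
have B1 : 0 < #|B'| by apply/card_gt0P; exists v.
have kAB : k * (r - k) <= #|A| * #|B'|.
  by rewrite /k -AB; exact: minn_product_le.
apply: leq_trans (leq_mul (leqnn 2) kAB) _.
have -> : 2 * (#|A| * #|B'|) = \sum_x \sum_y
    ((x \in A) * (y \in B') + (x \in B') * (y \in A)).
  have S (X Y : {set 'I_n}) : \sum_x \sum_y ((x \in X) * (y \in Y)) = #|X| * #|Y|.
    under eq_bigr do rewrite -big_distrr /=.
    by rewrite -big_distrl /= -!sum1_card ![\sum_(_ in _) _]big_mkcond.
  under eq_bigr do rewrite big_split /=.
  by rewrite big_split /= !S [#|B'| * _]mulnC mul2n addnn.
apply: leq_sum => x _; apply: leq_sum => y _.
have disj w : w \in A -> w \in B' = false by move=> wA; rewrite inE wA.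
case xA: (x \in A); case yB: (y \in B') => /=.
- rewrite disj // mul0n addn0; have [-> _ _] := AP _ xA; have [-> _ _] := BP _ yB.
  rewrite cross // eqxx andbT /= lt0b; apply: contraTneq yB => <-.
  by rewrite disj.
- by rewrite disj.
- case yA: (y \in A); last by rewrite muln0.
  by rewrite disj in yB.
case xB: (x \in B') => //; case yA: (y \in A) => //=.
have [-> _ _] := BP _ xB; have [-> _ _] := AP _ yA.
rewrite codegC cross // eqxx andbT /= lt0b; apply: contraTneq xB => ->.
by rewrite disj.
Qed.

End BookFree.

(** * The block construction *)

(** Here [g] names the block of a vertex and [side] the half containing it. With both ends of the
    spine in one block, a page outside it would have its two hyperedges equal, so the block would
    contain all [t + 2] vertices. *)
Lemma block_book_free (t n : nat) (T : eqType) (g : 'I_n -> T) (side : T -> bool)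
    (H : {set {set 'I_n}}) :
  0 < t ->
  (forall e x y, e \in H -> x \in e -> y \in e -> g x != g y ->
     side (g x) != side (g y) /\ e = [set z | (g z == g x) || (g z == g y)]) ->
  (forall e x, e \in H -> x \in e -> #|[set z | g z == g x]| <= t + 1) ->
  ~~ has_berge (book_E t) H.
Proof.
move=> t0 Hcross Hfib; apply/existsP => -[phi /andP[/injectiveP phi_inj]].
case/existsP => f /andP[/forall_inP fH /forall_inP f_inj].
have inc a b : [set a; b] \in book_E t ->
    [/\ f [set a; b] \in H, phi a \in f [set a; b] & phi b \in f [set a; b]].
  by move/fH; rewrite imsetU1 imset_set1 subUset !sub1set => /and3P[].
have neq e e' : e \in book_E t -> e' \in book_E t -> e != e' -> f e != f e'.
  move=> eE e'E; apply: contraNneq => fE.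
  by move/forall_inP: (f_inj e eE) => /(_ e' e'E); rewrite fE eqxx.
pose U : book_V t := None; pose W : book_V t := Some None.
pose X i : book_V t := Some (Some i).
have UW : [set U; W] \in book_E t by apply/book_edgeP; constructor 1.
have UX i : [set U; X i] \in book_E t by apply/book_edgeP; constructor 2; exists i.
have WX i : [set W; X i] \in book_E t by apply/book_edgeP; constructor 3; exists i.
have ne a b c : a != b -> a != c -> [set a; b] != [set b; c] :> {set book_V t}.
  move=> ab ac; apply: contraTneq (set21 a b) => ->.
  by rewrite !inE negb_or ab.
have nUX i : f [set U; X i] != f [set U; W].
  by apply: neq => //; rewrite [[set U; X i]]setUC ne.
have nWX i : f [set W; X i] != f [set U; W].
  by apply: neq => //; rewrite eq_sym ne.
have nX i : f [set U; X i] != f [set W; X i].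
  by apply: neq => //; rewrite [[set W; _]]setUC ne.
have [hH uh wh] := inc _ _ UW.
have [guw|guw] := eqVneq (g (phi U)) (g (phi W)).
  have gX i : g (phi (X i)) = g (phi U).
    apply/eqP; apply: contraNT (nX i); rewrite eq_sym => gne.
    have [pH up xp] := inc _ _ (UX i); have [qH wq xq] := inc _ _ (WX i).
    have [_ ->] := Hcross _ _ _ pH up xp gne.
    by rewrite guw in gne *; have [_ ->] := Hcross _ _ _ qH wq xq gne.
  have := Hfib _ _ hH uh; apply/negP; rewrite -ltnNge addn1.
  have -> : t.+2 = #|phi @: [set: book_V t]|.
    by rewrite card_imset // cardsT !card_option card_ord.
  apply/subset_leq_card/subsetP => z /imsetP[[[i|]|] _ ->]; rewrite inE ?gX //.
  by rewrite guw.
(* For a spine across two blocks one page suffices: if it shares a block with an end, one of its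
   hyperedges equals that of the spine; otherwise three vertices lie on pairwise different sides. *)
pose i := Ordinal t0.
have [suw hE] := Hcross _ _ _ hH uh wh guw.
have [pH up xp] := inc _ _ (UX i); have [qH wq xq] := inc _ _ (WX i).
have [gux|gux] := eqVneq (g (phi U)) (g (phi (X i))).
  have gwx : g (phi W) != g (phi (X i)) by rewrite -gux eq_sym.
  have [_ qE] := Hcross _ _ _ qH wq xq gwx.
  case/eqP: (nWX i); rewrite qE hE -gux.
  by apply/setP=> z; rewrite !inE orbC.
have [sux pE] := Hcross _ _ _ pH up xp gux.
have [gwx|gwx] := eqVneq (g (phi W)) (g (phi (X i))).
  by case/eqP: (nUX i); rewrite pE hE gwx.
have [swx _] := Hcross _ _ _ qH wq xq gwx.
by move: suw sux swx; do 3!case: (side _).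
Qed.

Lemma card_interval (n a m : nat) : a + m <= n ->
  #|[set x : 'I_n | a <= x < a + m]| = m.
Proof.
move=> le.
have lt (i : 'I_m) : a + i < n by apply: leq_trans le; rewrite ltn_add2l.
have inj : injective (fun i : 'I_m => Ordinal (lt i)).
  by move=> i j /(congr1 val) /= /addnI/val_inj.
rewrite -[RHS]card_ord -cardsT -(card_imset _ inj).
apply: eq_card => x; rewrite !inE; apply/andP/imsetP => [[ax xa]|[i _ ->]].
  have xm : x - a < m by rewrite ltn_subLR.
  by exists (Ordinal xm) => //; apply: val_inj; rewrite /= subnKC.
by rewrite /= leq_addr ltn_add2l.
Qed.

Lemma block_construction (t k l n : nat) :
  0 < t -> 0 < k -> 0 < l -> k <= t + 1 -> l <= t + 1 ->
  exists H : {set {set 'I_n}}, [/\ uniform (k + l) H, ~~ has_berge (book_E t) H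
    & #|H| = (n %/ (2 * k)) * (n %/ (2 * l))].
Proof.
move=> t0 k0 l0 kt lt; set p := n %/ (2 * k); set q := n %/ (2 * l).
have pq_le : p * k + q * l <= n.
  have := leq_trunc_div n (2 * k); have := leq_trunc_div n (2 * l).
  by rewrite -/p -/q; lia.
(* Left-over vertices get labels [inr j] with [q <= j], which no hyperedge uses. *)
pose g (x : 'I_n) : nat + nat :=
  if x < p * k then inl (x %/ k) else inr ((x - p * k) %/ l).
pose A i := [set x | g x == inl i].
pose B' j := [set x | g x == inr j].
have cA i : i < p -> #|A i| = k.
  move=> ip; have le : i * k + k <= p * k by rewrite -mulSnr leq_mul2r ip orbT.
  rewrite -[RHS](@card_interval n (i * k)); last by lia.
  apply: eq_card => x; rewrite !inE /g; case: ltnP => [xp|px].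
    by rewrite (inj_eq inl_inj) eqn_leq leq_divRL // andbC -[_ %/ _ <= _]ltnS ltn_divLR // mulSnr.
  by apply/esym/negP => /andP[]; lia.
have cB j : j < q -> #|B' j| = l.
  move=> jq; have le : j * l + l <= q * l by rewrite -mulSnr leq_mul2r jq orbT.
  rewrite -[RHS](@card_interval n (p * k + j * l)); last by lia.
  apply: eq_card => x; rewrite !inE /g; case: ltnP => [xp|px].
    by apply/esym/negP => /andP[]; lia.
  rewrite (inj_eq inr_inj) eqn_leq leq_divRL // andbC -[_ %/ _ <= _]ltnS ltn_divLR // mulSnr.
  by apply/andP/andP => -[]; lia.
pose E (ij : 'I_p * 'I_q) := A ij.1 :|: B' ij.2.
have E_inj : injective E.
  move=> [i j] [i' j'] /setP EE.
  have /card_gt0P[x] : 0 < #|A i| by rewrite cA.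
  have /card_gt0P[y] : 0 < #|B' j| by rewrite cB.
  move: (EE x) (EE y); rewrite !inE /= => Ex Ey /eqP gy /eqP gx.
  move: Ex Ey; rewrite gx gy !eqxx /= !orbF => /esym/eqP[/val_inj->].
  by move/esym/eqP => [/val_inj->].
exists [set E ij | ij : 'I_p * 'I_q]; split.
- apply/forall_inP => e /imsetP[[i j] _ ->]; rewrite cardsU cA // cB //.
  rewrite (_ : A i :&: B' j = set0) ?cards0 ?subn0 //.
  by apply/setP=> x; rewrite !inE; case: eqP => // ->.
- apply: (@block_book_free _ _ _ g (fun b => if b is inl _ then true else false)) => //.
    move=> e x y /imsetP[[i j] _ ->]; rewrite !inE /=.
    case/orP=> /eqP-> /orP[] /eqP->; rewrite ?eqxx // => _; split=> //.
      by apply/setP => z; rewrite !inE.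
    by apply/setP => z; rewrite !inE orbC.
  move=> e x /imsetP[[i j] _ ->]; rewrite !inE /=.
  by case/orP=> /eqP->; rewrite -?/(A i) -?/(B' j) ?cA ?cB.
- by rewrite card_imset // card_prod !card_ord.
Qed.

Lemma ex_berge_ge (r n : nat) (V : finType) (EF : {set {set V}}) (H : {set {set 'I_n}}) :
  uniform r H -> ~~ has_berge EF H -> #|H| <= ex_berge r n EF.
Proof.
by move=> Hr HF; apply: (@leq_bigmax_cond _ _ (fun H : {set {set 'I_n}} => #|H|)); rewrite Hr.
Qed.

Lemma ex_berge_le (r n m : nat) (V : finType) (EF : {set {set V}}) :
  (forall H : {set {set 'I_n}}, uniform r H -> ~~ has_berge EF H -> #|H| <= m) ->
  ex_berge r n EF <= m.
Proof. by move=> le; apply/bigmax_leqP => H /andP[]; exact: le. Qed.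

(** * Graphs whose edges lie in few triangles *)

Section EnergyIncrement.
Local Open Scope ring_scope.

(** The conditional expectation of [f] on the partition into fibres of [c]; [energy] is its squared
    norm. *)
Definition avg (U T : finType) (c : U -> T) (f : U -> rat) (u : U) : rat :=
  (\sum_(v | c v == c u) f v) / #|[pred v | c v == c u]|%:R.

Definition energy (U T : finType) (c : U -> T) (f : U -> rat) : rat :=
  \sum_u avg c f u ^+ 2.

Lemma class_gt0 (U T : finType) (c : U -> T) (u : U) :
  0 < #|[pred v | c v == c u]|%:R :> rat.
Proof. by rewrite ltr0n; apply/card_gt0P; exists u; rewrite inE. Qed.

Lemma avg_const (U T : finType) (c : U -> T) (f : U -> rat) (u v : U) :
  c u = c v -> avg c f u = avg c f v.
Proof. by rewrite /avg => ->. Qed.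

Lemma sum_avg (U T : finType) (c : U -> T) (f g : U -> rat) :
  (forall u v, c u = c v -> g u = g v) ->
  \sum_u avg c f u * g u = \sum_u f u * g u.
Proof.
move=> gc.
have E u : avg c f u * g u =
   \sum_v (if c v == c u then f v * g v / #|[pred w | c w == c v]|%:R else 0).
  rewrite /avg mulrAC !mulr_suml big_mkcond; apply: eq_bigr => v _.
  by case: eqP => // cE; rewrite cE (gc _ _ cE).
under eq_bigr => u _ do rewrite E.
rewrite exchange_big; apply: eq_bigr => v _ /=.
rewrite -big_mkcond /= sumr_const.
have -> : #|(fun u => c v == c u)| = #|[pred w | c w == c v]|.
  by apply: eq_card => w; rewrite !inE /= eq_sym.
rewrite -[_ *+ _]mulr_natr divfK //.
by rewrite gt_eqF // class_gt0.
Qed.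

Lemma avg_ge0 (U T : finType) (c : U -> T) (f : U -> rat) u :
  (forall v, 0 <= f v) -> 0 <= avg c f u.
Proof. by move=> f0; rewrite divr_ge0 ?ler0n // sumr_ge0. Qed.

Lemma avg_le1 (U T : finType) (c : U -> T) (f : U -> rat) u :
  (forall v, f v <= 1) -> avg c f u <= 1.
Proof.
move=> f1; rewrite ler_pdivrMr ?class_gt0 // mul1r.
by apply: le_trans (ler_sum _ (fun v _ => f1 v)) _; rewrite sumr_const.
Qed.

Lemma energy_le (U T : finType) (c : U -> T) (f : U -> rat) :
  (forall v, 0 <= f v <= 1) -> energy c f <= #|U|%:R.
Proof.
move=> f01; rewrite -sumr_const; apply: ler_sum => u _.
by rewrite exprn_ile1 ?avg_ge0 ?avg_le1 // => v; case/andP: (f01 v).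
Qed.

Lemma energy_ge0 (U T : finType) (c : U -> T) (f : U -> rat) :
  0 <= energy c f.
Proof. by apply: sumr_ge0 => u _; rewrite sqr_ge0. Qed.

(** The range of summation is a union of classes, so [f] may be replaced there by its average. *)
Lemma sum_low_avg (U T : finType) (c : U -> T) (f : U -> rat) (a : rat) :
  0 <= a -> \sum_(u | avg c f u < a) f u <= a * #|U|%:R.
Proof.
move=> a0; rewrite big_mkcond /=.
rewrite (eq_bigr (fun u => f u * (avg c f u < a)%R%:R)); last first.
  by move=> u _; case: ifP => _; rewrite ?mulr1 ?mulr0.
rewrite -(@sum_avg _ _ c) => [|u v cE]; last by rewrite (avg_const f cE).
rewrite mulr_natr -sumr_const; apply: ler_sum => u _.
by case: ltP => [/ltW|_]; rewrite ?mulr1 ?mulr0.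
Qed.

(** By Pythagoras the energy grows by the squared distance of the two averages. On [W], a union of
    classes of [c'], that square is bounded below through [(avg c' f u - avg c f u + s) ^+ 2 >= 0];
    elsewhere by 0. *)
Lemma energy_increment (U T T' : finType) (c : U -> T) (c' : U -> T')
    (f : U -> rat) (W : pred U) (s : rat) :
  (forall u v, c' u = c' v -> c u = c v) ->
  (forall u v, c' u = c' v -> W u = W v) ->
  energy c f + \sum_(u | W u) (2 * s * (avg c f u - f u) - s ^+ 2)
    <= energy c' f.
Proof.
move=> cc' cW.
have E1 : \sum_u avg c' f u * avg c f u = energy c f.
  rewrite (@sum_avg _ _ c') => [|u v /cc']; last exact: avg_const.
  rewrite -(@sum_avg _ _ c) => [|u v]; last exact: avg_const.
  by apply: eq_bigr => u _; rewrite expr2.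
have E2 : \sum_(u | W u) f u = \sum_(u | W u) avg c' f u.
  rewrite big_mkcond [RHS]big_mkcond /=.
  transitivity (\sum_u f u * (W u)%:R).
    by apply: eq_bigr => u _; case: (W u); rewrite ?mulr1 ?mulr0.
  rewrite -(@sum_avg _ _ c') => [|u v /cW -> //].
  by apply: eq_bigr => u _; case: (W u); rewrite ?mulr1 ?mulr0.
(* Averaging is an orthogonal projection. *)
have E3 : energy c' f = energy c f + \sum_u (avg c' f u - avg c f u) ^+ 2.
  under [X in _ = _ + X]eq_bigr => u _ do rewrite sqrrB.
  rewrite big_split sumrB /= -/(energy c f) -/(energy c' f).
  by rewrite sumrMnl E1; ring.
rewrite E3 lerD2l.
have -> : \sum_(u | W u) (2 * s * (avg c f u - f u) - s ^+ 2) =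
          \sum_(u | W u) (2 * s * (avg c f u - avg c' f u) - s ^+ 2).
  by rewrite !sumrB -!mulr_sumr !sumrB E2.
rewrite big_mkcond /=; apply: ler_sum => u _.
case: (W u); last exact: sqr_ge0.
rewrite -subr_ge0.
have -> : (avg c' f u - avg c f u) ^+ 2 -
   (2 * s * (avg c f u - avg c' f u) - s ^+ 2)
   = (avg c' f u - avg c f u + s) ^+ 2 by ring.
exact: sqr_ge0.
Qed.

(** * One refinement step for a graph whose edges lie in few triangles *)

Section Step.
Variables (V T : finType) (e : rel V) (K L : nat) (a : rat) (c : V -> T).
Hypothesis e_sym : symmetric e.
Hypothesis K_bound : forall x y, e x y -> (#|[pred z | e x z && e y z]| <= K)%N.
Hypothesis a_gt0 : 0 < a.
Hypothesis L_large : K%:R * 2 <= a ^+ 2 * L%:R.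

Let adj (p : V * V) : rat := (e p.1 p.2)%:R.
Let cc (p : V * V) := (c p.1, c p.2).
Let dens z x := avg c (fun x => (e z x)%:R) x.

(* [z] shows that the pair of classes [ij] is irregular: its density is at least
   [a], but the neighbourhood of [z] takes a share of at least [a] of both
   classes while inducing a graph of degree at most [K]. *)
Definition irregular (ij : T * T) (z : V) : bool :=
  [exists p, [&& cc p == ij, a <= avg cc adj p, a <= dens z p.1, a <= dens z p.2
    & (L <= #|[pred v | c v == c p.2]|)%N]].

(** One vertex for each pair of classes, so that the size of the refinement depends only on
    [#|T|]. *)
Definition witness (ij : T * T) : option V := [pick z | irregular ij z].

Definition refined (x : V) : T * {ffun T * T -> bool} :=
  (c x, [ffun ij => if witness ij is Some z then e z x else false]).

Let cc' (p : V * V) := (refined p.1, refined p.2).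

Let class_dens z x :
  #|[pred v | (c v == c x) && e z v]|%:R
  = dens z x * #|[pred v | c v == c x]|%:R :> rat.
Proof.
rewrite /dens /avg divfK ?gt_eqF ?class_gt0 //.
rewrite -natr_sum; congr (_%:R); rewrite -sum1_card big_mkcondr /=.
by apply: eq_bigr => v _; case: (e z v).
Qed.

(** In an irregular pair of classes [A], [B] with witness [z], let [A'], [B'] be the neighbours of
    [z]. Few edges run between them, so the density drops by at least [a / 2] on [A' * B'], a set of
    size at least [a ^+ 2 * A * B]. *)
Lemma energy_step :
  energy cc adj + a ^+ 4 / 4 * #|[pred p | witness (cc p)]|%:R
    <= energy cc' adj.
Proof.
(* The union of the products [A' * B']; the refinement records adjacency to witnesses precisely to
   make it a union of classes. *)
pose W p := if witness (cc p) is Some z then e z p.1 && e z p.2 else false.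
have W_meas u v : cc' u = cc' v -> W u = W v.
  case: u v => [x y] [x' y'] [cx /ffunP fx cy /ffunP fy].
  rewrite /W /cc /= -cx -cy.
  have := fx (c x, c y); have := fy (c x, c y); rewrite !ffunE.
  by case: witness => // z -> ->.
have cc_cc' u v : cc' u = cc' v -> cc u = cc v.
  by case: u v => [x y] [x' y'] [cx _ cy _]; rewrite /cc /= cx cy.
apply: le_trans (energy_increment adj (a / 2) cc_cc' W_meas).
rewrite lerD2l -sum1_card natr_sum mulr_sumr.
rewrite (partition_big cc xpredT) // [leRHS](partition_big cc xpredT) //=.
apply: ler_sum => ij _.
case Ew: (witness ij) => [z|]; last first.
  rewrite !big_pred0 // => p.
    by rewrite /W; case: eqP => [->|]; rewrite ?andbF // Ew.
  by rewrite inE; case: eqP => [->|]; rewrite ?andbF // Ew.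
have: irregular ij z by move: Ew; rewrite /witness; case: pickP => // ? ? [<-].
case/existsP=> -[x0 y0] /and5P[/eqP c0 d0 dx dy Lz].
rewrite /= in dx dy Lz; case: ij Ew c0 => i j Ew [ci cj].
rewrite (eq_bigl (fun p => (c p.1 == i) && (c p.2 == j))); last first.
  move=> p; rewrite inE /= /cc xpair_eqE; apply: andb_idl.
  by move=> /andP[/eqP-> /eqP->]; rewrite Ew.
rewrite sumr_const.
have -> : #|[pred p : V * V | (c p.1 == i) && (c p.2 == j)]| =
   (#|[pred v | c v == i]| * #|[pred v | c v == j]|)%N.
  by rewrite -cardX; apply: eq_card => p; rewrite !inE.
set A := #|[pred v | c v == i]|; set B := #|[pred v | c v == j]|.
pose d := avg cc adj (x0, y0).
rewrite (eq_big (fun p => (c p.1 == i) && e z p.1 && ((c p.2 == j) && e z p.2))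
  (fun p => (a * d - a ^+ 2 / 4) - a * (adj (p.1, p.2)))); first last.
- move=> p /andP[_ /eqP cp]; rewrite -surjective_pairing.
  rewrite (_ : avg cc adj p = d); last first.
    by apply: avg_const; rewrite cp /cc /= ci cj.
  by field.
- move=> p; rewrite /W /cc xpair_eqE /= andbC.
  case: eqP => [->|] //=; case: eqP => [->|] //=; last by rewrite !andbF.
  by rewrite Ew.
rewrite -(pair_big (fun x => (c x == i) && e z x) (fun y => (c y == j) && e z y)
  (fun x y => a * d - a ^+ 2 / 4 - a * adj (x, y))) /=.
set A' := #|[pred v | (c v == i) && e z v]|.
set B' := #|[pred v | (c v == j) && e z v]|.
have hA : a * A%:R <= A'%:R.
  by rewrite /A /A' -ci class_dens ler_wpM2r.
have hB : a * B%:R <= B'%:R.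
  by rewrite /B /B' -cj class_dens ler_wpM2r.
have hL : L%:R <= B%:R :> rat by rewrite ler_nat /B -cj.
(* The class has at least [L] vertices, so [a * B' >= a ^+ 2 * L >= 2 * K]. *)
have hKB : K%:R * 2 <= a * B'%:R.
  apply: le_trans L_large _; rewrite expr2 -mulrA ler_pM2l //.
  by apply: le_trans hB; rewrite ler_pM2l.
(* Each [x] in [A'] is adjacent to [z], so it has at most [K] neighbours in [B']. *)
apply: (@le_trans _ _ (\sum_(x | (c x == i) && e z x)
   ((a * d - a ^+ 2 / 4) * B'%:R - a * K%:R))); last first.
  apply: ler_sum => x /andP[_ zx].
  rewrite sumrB sumr_const mulr_natr lerD2l lerN2 -mulr_sumr ler_pM2l //.
  rewrite -natr_sum ler_nat.
  apply: leq_trans (K_bound zx).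
  rewrite -sum1_card [leqRHS]big_mkcond [leqLHS]big_mkcond /=.
  by apply: leq_sum => y _; rewrite inE; case: (c y == j); case: (e z y); case: (e x y).
rewrite sumr_const.
have -> : #|(fun x => (c x == i) && e z x)| = A' by apply: eq_card.
rewrite mulr1 -[X in X <= _]mulr_natr -[X in _ <= X]mulr_natr natrM.
have hd : a <= d by exact: d0.
clear hL; clearbody A B A' B' d.
have A0 : 0 <= A%:R :> rat by exact: ler0n.
have B0 : 0 <= B%:R :> rat by exact: ler0n.
have A'0 : 0 <= A'%:R :> rat by exact: ler0n.
have B'0 : 0 <= B'%:R :> rat by exact: ler0n.
move: hA hB hKB hd A0 B0 A'0 B'0; move: (A%:R) (B%:R) (A'%:R) (B'%:R) (K%:R) => {}A {}B {}A' {}B' k hA hB hK hd A0 B0 A'0 B'0.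
apply: (@le_trans _ _ (a ^+ 2 / 4 * (A' * B'))).
  rewrite (_ : a ^+ 4 / 4 * (A * B) = a ^+ 2 / 4 * ((a * A) * (a * B))); last by field.
  rewrite ler_wpM2l ?divr_ge0 ?sqr_ge0 //.
  by rewrite ler_pM // mulr_ge0 // ltW.
rewrite (_ : a ^+ 2 / 4 * (A' * B') = (a ^+ 2 / 4 * B') * A'); last by ring.
rewrite ler_wpM2r //.
have h1 : a * a * B' <= a * d * B' by rewrite ler_wpM2r // ler_pM2l.
have h2 : a * (k * 2) <= a * (a * B') by rewrite ler_pM2l.
rewrite expr2; lra.
Qed.

Let low_pairs :
  (\sum_x \sum_y ((e x y && (avg cc adj (x, y) < a)%R) : nat))%:R
    <= a * #|V|%:R ^+ 2 :> rat.
Proof.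
have := @sum_low_avg _ _ cc adj a (ltW a_gt0).
rewrite card_prod natrM -expr2; apply: le_trans.
rewrite pair_bigA natr_sum [leRHS]big_mkcond /=; apply: ler_sum => -[x y] _ /=.
by rewrite /adj /=; case: (e x y); case: ifP.
Qed.

Let small_classes :
  (\sum_y (#|[pred v | c v == c y]| < L)%N <= #|T| * L)%N.
Proof.
rewrite (partition_big c xpredT) //= -sum_nat_const; apply: leq_sum => t _.
rewrite (eq_bigr (fun=> (#|[pred v | c v == t]| < L)%N : nat)) => [|y /eqP-> //].
by rewrite sum_nat_const; case: ltnP => [/ltnW|]; rewrite ?muln1 ?muln0.
Qed.

(** For an adjacent pair [z x] there are at most [K] choices of [y]; for fixed [z], [sum_low_avg]
    allows at most [a * #|V|] vertices [x]. *)
Let low_triangles :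
  (\sum_x \sum_y \sum_z
      ([&& e x y, e x z & e y z] && (dens z x < a)%R))%:R
    <= K%:R * (a * #|V|%:R ^+ 2) :> rat.
Proof.
apply: (@le_trans _ _
    (\sum_z K * \sum_x (e z x && (dens z x < a)%R))%N%:R).
  rewrite ler_nat.
  under eq_bigr do rewrite exchange_big.
  rewrite exchange_big; apply: leq_sum => z _.
  rewrite big_distrr /=; apply: leq_sum => x _.
  case zx: (e z x); last first.
    by rewrite big1 // => y _; rewrite (e_sym x z) zx andbF.
  case: (dens z x < a); last first.
    by rewrite big1 // => y _; rewrite andbF.
  rewrite muln1; apply: leq_trans (K_bound zx).
  rewrite -sum1_card [leqRHS]big_mkcond /=; apply: leq_sum => y _; rewrite inE.
  by rewrite (e_sym x z) zx (e_sym y z); case: (e z y); case: (e x y).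
rewrite -big_distrr natrM ler_wpM2l ?ler0n // natr_sum expr2 mulrA mulr_natr.
rewrite -sumr_const; apply: ler_sum => z _.
apply: le_trans (sum_low_avg c (fun x => (e z x)%:R) (ltW a_gt0)).
rewrite natr_sum [leRHS]big_mkcond /=; apply: ler_sum => x _ /=.
by rewrite /dens; case: (e z x); case: ifP.
Qed.

(** If the classes of an edge [x y] have a witness or low density, or that of [y] is small, the edge
    accounts for at most [K] triangles. Otherwise each [z] completing a triangle has low density in
    the class of [x] or of [y], since else it would make the pair irregular. *)
Lemma triangles_le :
  (triangles e)%:R <= K%:R * (#|[pred p | witness (cc p)]|%:R
    + 3 * a * #|V|%:R ^+ 2 + #|V|%:R * (#|T| * L)%:R) :> rat.
Proof.
pose wit x y := witness (c x, c y) : bool.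
pose low x y := (avg cc adj (x, y) < a)%R.
pose small y := (#|[pred v | c v == c y]| < L)%N.
have H : (triangles e <=
    K * (\sum_x \sum_y (wit x y : nat) + \sum_x \sum_y (e x y && low x y : nat)
         + \sum_(x : V) \sum_y (small y : nat))
    + (\sum_x \sum_y \sum_z ([&& e x y, e x z & e y z] && (dens z x < a)%R : nat)
    + \sum_y \sum_x \sum_z ([&& e y x, e y z & e x z] && (dens z y < a)%R : nat)))%N.
  rewrite [X in (_ <= _ + (_ + X))%N]exchange_big -!big_split big_distrr /=.
  rewrite -big_split; apply: leq_sum => x _ /=.
  rewrite -!big_split big_distrr -big_split; apply: leq_sum => y _ /=.
  case xy: (e x y) => /=; last by rewrite big1.
  have [|none] := boolP [|| wit x y, low x y | small y].
    move=> some; apply: (@leq_trans K).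
      apply: leq_trans (K_bound xy).
      by rewrite -sum1_card [leqRHS]big_mkcond; apply: leq_sum => z _; rewrite inE; case: andP.
    by apply: leq_trans (leq_addr _ _); case/or3P: some => ->; rewrite leq_pmulr // ?addn1 ?add1n // addnC.
  apply: leq_trans (leq_addl _ _); rewrite -big_split; apply: leq_sum => z _ /=.
  rewrite (e_sym y x) xy /= [X in (_ <= _ + (X && _))%N]andbC.
  case xyz: (e x z && e y z) => //=.
  case: (ltP (dens z x) a) => dx //; case: (ltP (dens z y) a) => dy //.
  case/negP: none; rewrite /wit /low /small.
  have irr : irregular (c x, c y) z \/ low x y || small y.
    rewrite /low /small ltNge ltnNge -negb_and; case: andP => [[d l]|]; last by right.
    by left; apply/existsP; exists (x, y); apply/and5P.
  case: irr => [irr|->]; last by rewrite orbT.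
  by rewrite /witness; case: pickP => // /(_ z); rewrite irr.
apply: le_trans (_ : (_ <= (_ : nat)%:R)) _; first by rewrite ler_nat; exact: H.
rewrite !natrD natrM !natrD.
have S1 : (\sum_x \sum_y (wit x y : nat))%:R = #|[pred p | witness (cc p)]|%:R :> rat.
  congr (_%:R); rewrite pair_bigA -sum1_card [RHS]big_mkcond /=.
  by apply: eq_bigr => -[x y] _; rewrite inE /wit /=; case: witness.
have S3 : (\sum_(x : V) \sum_y (small y : nat))%:R <= #|V|%:R * (#|T| * L)%:R :> rat.
  by rewrite -natrM ler_nat -sum_nat_const; apply: leq_sum => x _; exact: small_classes.
have S2 := low_pairs; have S4 := low_triangles.
have K0 : 0 <= K%:R :> rat by exact: ler0n.
rewrite S1.
have h1 := ler_wpM2l K0 S2; have h2 := ler_wpM2l K0 S3.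
apply: (@le_trans _ _ (K%:R * #|[pred p | witness (cc p)]|%:R
  + K%:R * (a * #|V|%:R ^+ 2) + K%:R * (#|V|%:R * (#|T| * L)%:R)
  + (K%:R * (a * #|V|%:R ^+ 2) + K%:R * (a * #|V|%:R ^+ 2)))).
  by rewrite !mulrDr !lerD.
by rewrite le_eqVlt; apply/orP; left; apply/eqP; ring.
Qed.

End Step.

(* Energy increment: as long as there are many triangles, every partition can be
   refined so that its energy, at most [#|V| ^ 2], grows by [d * #|V| ^ 2]. *)
Lemma ruzsa_szemeredi (K q : nat) : exists N : nat,
  forall (V : finType) (e : rel V), (N <= #|V|)%N -> symmetric e ->
  (forall x y, e x y -> (#|[pred z | e x z && e y z]| <= K)%N) ->
  (q * triangles e <= #|V| ^ 2)%N.
Proof.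
wlog K0 : K / (0 < K)%N.
  move=> H; have [N HN] := H K.+1 isT; exists N => V e nV es eK.
  by apply: HN => // x y /eK/leqW.
wlog q0 : q / (0 < q)%N.
  by move=> H; case: (posnP q) => [->|/H //]; exists 0%N.
(* The low-density terms of [triangles_le] become [#|V| ^ 2 / (4 q)], [L] gives
   [a ^+ 2 * L = 2 * K], and [d] is the gain from [#|V| ^ 2 / (2 q K)] pairs with a witness. *)
pose a : rat := ((12 * q * K)%:R)^-1.
pose L := (2 * K * (12 * q * K) ^ 2)%N.
pose d : rat := a ^+ 4 / (8 * q * K)%:R.
have den_gt0 : 0 < (12 * q * K)%:R :> rat by rewrite ltr0n !muln_gt0 q0 K0.
have a0 : 0 < a by rewrite invr_gt0.
have d0 : 0 < d by rewrite divr_gt0 ?exprn_gt0 // ltr0n !muln_gt0 q0 K0.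
have aL : K%:R * 2 <= a ^+ 2 * L%:R.
  rewrite /L natrM natrX natrM /a exprVn mulrCA mulVf ?mulr1 1?mulrC //.
  by rewrite expf_neq0 // gt_eqF.
(* Here [s] counts the increments still possible and [m] bounds the number of classes; [N] depends
   on nothing else. *)
suff iter s m : exists N : nat, forall (V T : finType) (e : rel V) (c : V -> T),
    (N <= #|V|)%N -> symmetric e ->
    (forall x y, e x y -> (#|[pred z | e x z && e y z]| <= K)%N) ->
    (#|V| ^ 2 < q * triangles e)%N -> (#|T| <= m)%N ->
    #|V|%:R ^+ 2 * (1 - d * s%:R) <= energy (fun p => (c p.1, c p.2))
        (fun p : V * V => (e p.1 p.2)%:R) -> False.
  pose s := (Num.truncn d^-1).+1.
  have [N HN] := iter s 1%N; exists N => V e nV es eK.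
  rewrite leqNgt; apply/negP => many.
  apply: (HN V unit e (fun=> tt)) => //; first by rewrite card_unit.
  apply: le_trans (energy_ge0 _ _); rewrite pmulr_rle0; last first.
    rewrite exprn_gt0 // ltr0n lt0n; apply/negP => V0.
    move: many; rewrite /triangles big_pred0 ?muln0 // => x.
    by move/eqP/card0_eq: V0 => /(_ x).
  have : d^-1 < s%:R by rewrite truncnS_gt.
  rewrite -(ltr_pM2l d0) divff ?gt_eqF // => ?; lra.
(* From this size on, small classes account for at most [#|V| ^ 2 / (4 q)] triangles. *)
pose N0 m := (4 * q * K * m * L).+1.
have step m' (V T : finType) (e : rel V) (c : V -> T) : (N0 m' <= #|V|)%N ->
    symmetric e ->
    (forall x y, e x y -> (#|[pred z | e x z && e y z]| <= K)%N) ->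
    (#|V| ^ 2 < q * triangles e)%N -> (#|T| <= m')%N ->
    energy (fun p => (c p.1, c p.2)) (fun p : V * V => (e p.1 p.2)%:R)
      + d * #|V|%:R ^+ 2
    <= energy (fun p => (refined e L a c p.1, refined e L a c p.2))
         (fun p : V * V => (e p.1 p.2)%:R).
  move=> nV es eK many mT.
  apply: le_trans (energy_step c eK a0 aL); rewrite lerD2l.
  have := triangles_le L c es eK a0; set w := #|_|%:R => tri.
  have n0 : 0 < #|V|%:R :> rat by rewrite ltr0n; apply: leq_trans nV.
  have Q0 : 0 < q%:R :> rat by rewrite ltr0n.
  have k0 : 0 < K%:R :> rat by rewrite ltr0n.
  have many' : #|V|%:R ^+ 2 < q%:R * (triangles e)%:R :> rat.
    by rewrite -natrX -natrM ltr_nat.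
  have aE : 12 * q%:R * K%:R * a = 1.
    by rewrite /a -!natrM divff ?gt_eqF.
  have small : 4 * q%:R * K%:R * (#|T| * L)%:R <= #|V|%:R :> rat.
    rewrite -!natrM ler_nat; apply: leq_trans (ltnW nV).
    by rewrite -[leqRHS]mulnA leq_mul2l leq_mul2r mT !orbT.
  have tri' := ler_wpM2l (ltW Q0) tri.
  have small' := ler_wpM2l (ltW n0) small.
  have W : #|V|%:R ^+ 2 <= 2 * q%:R * K%:R * w.
    have aE2 : q%:R * (K%:R * (3 * a * #|V|%:R ^+ 2)) = #|V|%:R ^+ 2 / 4.
      by rewrite -[_ / _]mul1r -[X in X * (_ / _)]aE; field.
    rewrite !mulrDr aE2 in tri'; lra.
  rewrite /d !natrM mulrAC ler_pdivrMr ?mulr_gt0 //.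
  rewrite [leRHS](_ : _ = a ^+ 4 * (2 * q%:R * K%:R * w)); last by field.
  by rewrite ler_pM2l ?exprn_gt0.
elim: s m => [|s IH] m.
  exists (N0 m) => V T e c nV es eK many mT.
  rewrite mulr0 subr0 mulr1 => en.
  have n0 : 0 < d * #|V|%:R ^+ 2.
    by rewrite mulr_gt0 // exprn_gt0 // ltr0n; apply: leq_trans nV.
  suff: d * #|V|%:R ^+ 2 <= 0 by rewrite leNgt n0.
  rewrite -(lerD2l (#|V|%:R ^+ 2)) addr0.
  apply: le_trans (lerD en (lexx _)) _.
  apply: le_trans (step _ _ _ _ c nV es eK many mT) _.
  rewrite expr2 -natrM -card_prod; apply: energy_le => p.
  by case: (e _ _).
(* A refined class is an old class with one bit for each pair of classes. *)
have [N HN] := IH (m * 2 ^ (m * m))%N.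
exists (maxn (N0 m) N) => V T e c; rewrite geq_max => /andP[nV nV'] es eK many mT en.
apply: (HN V _ e (refined e L a c)) => //.
  rewrite card_prod card_ffun card_bool card_prod.
  by rewrite leq_mul // leq_exp2l // leq_mul.
apply: le_trans (step _ _ _ _ c nV es eK many mT).
apply: le_trans (lerD en (lexx _)).
rewrite le_eqVlt; apply/orP; left; apply/eqP; rewrite -[s.+1]addn1 natrD; ring.
Qed.

End EnergyIncrement.

(** * The asymptotics *)

Lemma sum_private_pairs_le (V : finType) (H F : {set {set V}}) : F \subset H ->
  \sum_(h in F) \sum_x \sum_y [&& x \in h, y \in h, x != y & codeg H x y == 1]
    <= \sum_x \sum_y linked H 1 x y.
Proof.
move=> FH; rewrite exchange_big; apply: leq_sum => x _.
rewrite exchange_big; apply: leq_sum => y _ /=.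
have [c1|cN] := boolP ((x != y) && (codeg H x y == 1)); last first.
  rewrite big1 // => h _; rewrite (negPf (_ : ~~ [&& _, _ & _])) //.
  by apply: contra cN => /and3P[].
have [xy /eqP c] := andP c1; rewrite /linked xy c /=.
rewrite -[leqRHS]c /codeg -sum1_card big_mkcond [leqRHS]big_mkcond.
apply: leq_sum => h _; rewrite inE; case: ifP => // hF.
by rewrite (subsetP FH) //=; case: (x \in h); case: (y \in h).
Qed.

(** The triangle term in Mantel's inequality is at most [n ^ 4 / q]. If [s] exceeded the bound, then
    [n ^ 2 <= 2 * s] and the term would be too small to compensate. *)
Lemma few_triangles_edges (q T n s tri : nat) :
  2 * s ^ 2 <= n ^ 2 * s + n * tri -> tri <= T * n ^ 2 -> q * T <= n ->
  2 * q * s <= (q + 2) * n ^ 2.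
Proof.
move=> mant triT nT; rewrite leqNgt; apply/negP => big.
have h1 : q * (n * tri) <= n ^ 4.
  apply: (@leq_trans (q * (n * (T * n ^ 2)))); first by rewrite !leq_mul2l triT !orbT.
  rewrite (_ : q * (n * (T * n ^ 2)) = q * T * n ^ 3); last by ring.
  by rewrite (expnS n 3) leq_mul2r nT orbT.
have h2 : q * (2 * s ^ 2) <= q * (n ^ 2 * s) + n ^ 4.
  by apply: leq_trans (leq_mul (leqnn q) mant) _; rewrite mulnDr leq_add2l.
have h3 : n ^ 2 <= 2 * s by nia.
have s0 : 0 < s by nia.
have h4 : q * (n ^ 2 * s) + 2 * n ^ 2 * s < q * (2 * s ^ 2) by nia.
have h5 : n ^ 4 = n ^ 2 * n ^ 2 by rewrite -expnD.
nia.
Qed.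

(** Three exceptional families have at most [n ^ 2 / q] members each; every other hyperedge owns
    [2 * P] ordered private pairs, of which there are at most [(1 + 2 / q) * n ^ 2 / 2]. *)
Lemma book_free_upper (t r q : nat) : 2 <= r -> 0 < q ->
  let k := minn (r - 1) (t + 1) in
  exists N, forall n (H : {set {set 'I_n}}), N <= n ->
    uniform r H -> ~~ has_berge (book_E t) H ->
    4 * (k * (r - k)) * q * #|H| <= (q + 2 + 12 * (k * (r - k))) * n ^ 2.
Proof.
move=> r2 q0 k; set P := k * (r - k).
pose C := r * (2 * t + 1); pose B := 2 ^ (C + 2).
have C0 : 0 < C by rewrite /C; nia.
have B0 : 0 < B by rewrite expn_gt0.
have r0 : 0 < r ^ 2 by rewrite expn_gt0; lia.
have CB0 : 0 < C * r ^ 2 * B by rewrite (muln_gt0 (C * r ^ 2)) (muln_gt0 C) C0 r0 B0.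
have BB0 : 0 < B * r ^ 2 * B by rewrite (muln_gt0 (B * r ^ 2)) (muln_gt0 B) r0 B0.
(* With [#|H| <= n ^ 2 * B], these [L] and [D] bring the unbalanced and the all-heavy hyperedges
   down to [n ^ 2 / q]; the last factor of [D] makes it exceed the size of the book. *)
pose L := q * (C * r ^ 2 * B).
pose D := q * (B * r ^ 2 * B) * #|book_E t|.+1.
have L0 : 0 < L by rewrite (muln_gt0 q) q0.
have D0 : 0 < D by rewrite (muln_gt0 (q * _)) (muln_gt0 q) q0 BB0.
pose M := L * D.
pose T := C + r * (r ^ 2 * B).
(* A light pair has at most [C + M * r] common neighbours; the factor [M] in [q * M] pays for the
   hyperedges on one light triangle. *)
have [N HN] := ruzsa_szemeredi (C + M * r) (q * M).
exists (maxn N (q * T)) => n H; rewrite geq_max => /andP[nN nT] Hr Hf.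
have cH : #|H| <= n ^ 2 * B := card_book_free r2 Hr Hf.
set F1 := [set h in H | [exists u in h, exists v in h, exists x in h,
     [&& u != v, x \in apexes H u v & L * codeg H u x < codeg H u v]]].
set F2 := [set h in H | [exists u in h, exists v in h, exists x in h,
     [&& linked H M u v, linked H M u x & linked H M v x]]].
set F3 := [set h in H | [forall x in h, forall y in h,
     (x != y) ==> (D < codeg H x y)]].
have f1 : q * #|F1| <= n ^ 2.
  rewrite -(@leq_pmul2l (C * r ^ 2 * B)) //.
  rewrite mulnA (mulnC _ q) -/L.
  apply: leq_trans (card_unbalanced Hr Hf L) _.
  by rewrite -[leqRHS]mulnA leq_mul2l [B * _]mulnC cH orbT.
have f3 : q * #|F3| <= n ^ 2.
  rewrite -(@leq_pmul2l (B * r ^ 2 * B)) //.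
  rewrite mulnA (mulnC _ q).
  apply: (@leq_trans (D * #|F3|)); first by rewrite leq_mul2r leq_pmulr ?orbT.
  apply: leq_trans (card_all_heavy r2 Hr Hf D0) _.
  by rewrite -[leqRHS]mulnA leq_mul2l [B * _]mulnC cH orbT.
have f2 : q * #|F2| <= n ^ 2.
  apply: leq_trans (leq_mul (leqnn q) (card_light_triangles H M)) _.
  rewrite mulnA; have := HN _ (linked H M); rewrite card_ord; apply=> //.
    exact: linked_sym.
  move=> x y xy; apply: leq_trans (linked_common Hr Hf xy) _.
  by rewrite leq_add2l leq_mul2r; case/and3P: xy => _ _ ->; rewrite orbT.
set s := \sum_x \sum_y linked H 1 x y.
have sn : 2 * q * s <= (q + 2) * n ^ 2.
  have := mantel (@linked_sym _ H 1); rewrite card_ord -/s => mant.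
  apply: few_triangles_edges mant _ nT.
  apply: leq_trans (shadow_triangles Hr Hf 1) _; rewrite /T mulnDl leq_add2l.
  by rewrite -!mulnA !leq_mul2l [B * _]mulnC cH !orbT.
set F := H :\: (F1 :|: F2 :|: F3).
have Fs : 2 * P * #|F| <= s.
  apply: leq_trans (sum_private_pairs_le (subsetDl H (F1 :|: F2 :|: F3))).
  rewrite mulnC -sum_nat_const; apply: leq_sum => h.
  rewrite !inE => /andP[+ hH]; rewrite hH !negb_or /= => /andP[/andP[b1 b2] b3].
  apply: (private_pairs_ge Hr Hf hH D0 L0 _ b3 b1 b2).
  by apply: leq_trans (leqnSn _) _; rewrite leq_pmull // (muln_gt0 q) q0 BB0.
have HF : #|H| <= #|F| + (#|F1| + #|F2| + #|F3|).
  rewrite -(cardsID (F1 :|: F2 :|: F3) H) addnC leq_add2l.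
  apply: leq_trans (subset_leq_card (subsetIr _ _)) _.
  apply: leq_trans (leq_card_setU _ _) _; rewrite leq_add2r.
  exact: leq_card_setU.
apply: (@leq_trans (2 * q * s + 4 * P * (q * #|F1| + q * #|F2| + q * #|F3|))); last first.
  apply: (@leq_trans ((q + 2) * n ^ 2 + 4 * P * (n ^ 2 + n ^ 2 + n ^ 2))).
    by rewrite leq_add // leq_mul2l !leq_add ?orbT.
  by rewrite leq_eqVlt; apply/orP; left; apply/eqP; ring.
apply: leq_trans (leq_mul (leqnn _) HF) _; rewrite -!mulnDr mulnDr leq_add //.
  rewrite (_ : 4 * P * q * _ = 2 * q * (2 * P * #|F|)); last by ring.
  by rewrite leq_mul2l Fs orbT.
by rewrite mulnA.
Qed.

Local Open Scope ring_scope.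

(** The remainders of the two divisions are below [2 * k] and [2 * l], which costs at most
    [2 * (k + l) * n]. *)
Lemma block_count (k l n : nat) : (0 < k)%N -> (0 < l)%N ->
  (n ^ 2 <= 4 * (k * l) * ((n %/ (2 * k)) * (n %/ (2 * l))) + 2 * (k + l) * n)%N.
Proof.
move=> k0 l0.
have k2 : (0 < 2 * k)%N by rewrite muln_gt0.
have l2 : (0 < 2 * l)%N by rewrite muln_gt0.
have := ltn_pmod n k2; have := ltn_pmod n l2.
have := divn_eq n (2 * k); have := divn_eq n (2 * l).
move: (n %/ _)%N (n %/ _)%N (n %% _)%N (n %% _)%N => a b x y nb na yl xk.
have -> : (n ^ 2 = a * (2 * k) * (b * (2 * l)) + a * (2 * k) * y + x * n)%N.
  by rewrite -mulnn {1}na mulnDl {1}nb mulnDr.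
have h1 : (a * (2 * k) * y <= n * (2 * l))%N.
  by rewrite leq_mul ?(ltnW yl) // na leq_addr.
have h2 : (x * n <= 2 * k * n)%N by rewrite leq_mul2r (ltnW xk) orbT.
apply: leq_trans (leq_add (leq_add (leqnn _) h1) h2) _.
by rewrite leq_eqVlt; apply/orP; left; apply/eqP; ring.
Qed.

Theorem theorem4 (t r : nat) :
  (1 <= t)%N -> (2 <= r)%N -> (r <= 2 * t + 2)%N ->
  let k := minn (r - 1) (t + 1) in
  forall eps : rat, 0 < eps ->
  exists N : nat, forall n : nat, (N <= n)%N ->
    `| (ex_berge r n (book_E t))%:R
       - (n ^ 2)%:R / (4 * k * (r - k))%:R | <= eps * (n ^ 2)%:R.
Proof.
move=> t1 r2 rt k eps eps0.
(* The bound [r <= 2 * t + 2] enters through [r - k <= t + 1]. *)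
have [k0 l0 kt lt] : [/\ 0 < k, 0 < r - k, k <= t + 1 & r - k <= t + 1]%N.
  by rewrite /k; split; lia.
have klr : (k + (r - k) = r)%N by rewrite /k; lia.
(* This [q] makes the upper error [(2 + 12 * P) * n ^ 2] at most [eps * q * n ^ 2]. *)
have [N HN] := @book_free_upper t r
  (Num.truncn ((2 + 12 * (k * (r - k)))%:R / eps)).+1 r2 isT.
set q := (Num.truncn _).+1 in HN; rewrite -/k in HN.
move: HN; rewrite -(mulnA 4 k); have qE : (2 + 12 * (k * (r - k)))%:R <= eps * q%:R.
  by rewrite mulrC -ler_pdivrMr // ltW // truncnS_gt.
move: qE; set P := (k * (r - k))%N => qE HN.
have P0 : (0 < 4 * P)%N by rewrite !muln_gt0 k0.
have P4 : 1 <= (4 * P)%:R :> rat by rewrite ler1n.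
have P40 : 0 < (4 * P)%:R :> rat by exact: lt_le_trans P4.
(* The second bound on [n] absorbs the rounding loss [2 * r * n] of the construction. *)
exists (maxn N (Num.truncn ((2 * r)%:R / eps)).+1) => n.
rewrite geq_max => /andP[nN nN'].
set X := ex_berge r n (book_E t).
have nE : (2 * r)%:R <= eps * n%:R.
  rewrite mulrC -ler_pdivrMr // ltW //.
  by apply: lt_le_trans (truncnS_gt _) _; rewrite ler_nat.
have upper : (4 * P * q * X <= (q + 2 + 12 * P) * n ^ 2)%N.
  have Pq0 : (0 < 4 * P * q)%N by rewrite (muln_gt0 (4 * P)) P0.
  rewrite mulnC -leq_divRL // /X; apply: ex_berge_le => H Hr Hf.
  by rewrite leq_divRL // mulnC HN.
have lower : (n ^ 2 <= 4 * P * X + 2 * r * n)%N.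
  have [H [Hr Hf HE]] := @block_construction t k (r - k) n t1 k0 l0 kt lt.
  apply: leq_trans (block_count n k0 l0) _.
  rewrite klr -HE leq_add2r leq_mul2l; apply/orP; right.
  by rewrite /X; apply: ex_berge_ge Hf; rewrite -{1}klr.
have q0 : 0 < q%:R :> rat by rewrite ltr0n.
have n0 : 0 <= (n ^ 2)%:R :> rat by exact: ler0n.
rewrite -(ler_pM2l P40) -[X in X * `|_|](gtr0_norm P40) -normrM mulrBr.
rewrite [_ * (_ / _)]mulrC divfK ?gt_eqF // ler_norml; apply/andP; split.
  rewrite lerBrDr addrC lerBlDr.
  move: lower; rewrite -(ler_nat rat) natrD => /le_trans; apply.
  rewrite natrM lerD2l.
  have h : (2 * r * n)%:R <= eps * (n ^ 2)%:R :> rat.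
    by rewrite -mulnn !natrM mulrA ler_wpM2r ?ler0n // -natrM.
  apply: le_trans h _; rewrite ler_peMl //.
  by rewrite mulr_ge0 // ltW.
rewrite lerBlDr -(ler_pM2l q0).
move: upper; rewrite -(ler_nat rat) => up.
have -> : q%:R * ((4 * P)%:R * X%:R) = (4 * P * q * X)%:R :> rat.
  by rewrite !natrM; ring.
apply: le_trans up _.
rewrite natrM -addnA natrD mulrDl addrC mulrDr lerD2r.
rewrite mulrCA mulrA.
have h : (2 + 12 * P)%:R * (n ^ 2)%:R <= eps * q%:R * (n ^ 2)%:R.
  by rewrite ler_wpM2r.
apply: le_trans h _.
rewrite (_ : (4 * P)%:R * q%:R * _ = (4 * P)%:R * (eps * q%:R * (n ^ 2)%:R)); last by ring.
by rewrite ler_peMl // !mulr_ge0 // ltW.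
Qed.
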